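(* Fix an integer $n\ge2$. Let $F$ and $G$ be nondegenerate laws on $\mathbb R$, symmetric about zero and with no atom at zero, and let $a$ and $b$ be the quantile functions of the absolute values of random variables with laws $F$ and $G$, respectively. Suppose $a(u)/b(u)$ is nondecreasing on $(0,1)$. Then, for every integer $m\ge0$, $$\mathbb E Z_F^{2m}\le\mathbb E Z_G^{2m}.$$ If $a/b$ is not almost everywhere constant, the inequality is strict for every $m\ge2$. Consequently, whenever $c_m\ge0$ for all $m\ge 0$ and $\sum_{m\ge0}c_mx^{2m}$ converges on $[-\sqrt n,\sqrt n]$, $$\mathbb E\sum_{m\ge0}c_mZ_F^{2m}\le\mathbb E\sum_{m\ge0}c_mZ_G^{2m}.$$
   Context: For a law $F$ on $\mathbb R$ with no atom at zero, and $X_1,\dots,X_n$ i.i.d. from $F$, write $$Z_F=\frac{X_1+\cdots+X_n}{(X_1^2+\cdots+X_n^2)^{1/2}}.$$ *)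

(* Defs.v *)
From HB Require Import structures.
From mathcomp Require Import all_boot all_order all_algebra.
From mathcomp Require Import all_classical all_reals all_analysis.
From mathcomp Require Import measurable_realfun.

Set Implicit Arguments.
Unset Strict Implicit.
Unset Printing Implicit Defensive.

Import Order.TTheory GRing.Theory Num.Theory.
Import numFieldNormedType.Exports.

Local Open Scope classical_set_scope.
Local Open Scope ring_scope.

Definition nondegenerate_law (R : realType) (F : probability R R) : Prop :=
  ~ exists x : R, F [set x] = 1%E.

Definition symmetric_law (R : realType) (F : probability R R) : Prop :=
  forall A : set R, measurable A -> F (-%R @^-1` A) = F A.

Definition no_atom_at_zero (R : realType) (F : probability R R) : Prop :=
  F [set 0] = 0%E.

(* For 0 < u < 1 the set is nonempty and bounded below, so [inf] is a genuine
   infimum. *)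
Definition quantile d (T : measurableType d) (R : realType)
    (P : probability T R) (X : {RV P >-> R}) (u : R) : R :=
  inf [set x : R | (u%:E <= cdf X x)%E].

(* On the probability space (R, F) the identity has law F, so [normr] is the
   absolute value of a random variable with law F. *)
Definition abs_quantile (R : realType) (F : probability R R) : R -> R :=
  quantile (@Num.norm R R : {RV F >-> R}).

Definition mutually_independent d (T : measurableType d) (R : realType)
    (P : probability T R) (I : finType) (X : I -> {RV P >-> R}) : Prop :=
  forall (J : {set I}) (A : I -> set R), (forall i, measurable (A i)) ->
    P (\bigcap_(i in [set` J]) (X i @^-1` A i)) =
    (\prod_(i in J) P (X i @^-1` A i))%E.

(* Laws are compared on measurable sets only: the value of a measure on a
   non-measurable set is unspecified. *)
Definition has_law d (T : measurableType d) (R : realType)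
    (P : probability T R) (X : {RV P >-> R}) (F : probability R R) : Prop :=
  forall A : set R, measurable A -> distribution P X A = F A.

Definition iid_sample d (T : measurableType d) (R : realType)
    (P : probability T R) (n : nat) (X : 'I_n -> {RV P >-> R})
    (F : probability R R) : Prop :=
  mutually_independent X /\ forall i, has_law (X i) F.

(* The value is 0 where all [X i w] vanish; this is a null event when the
   common law of the [X i] has no atom at zero. *)
Definition self_normalized_sum d (T : measurableType d) (R : realType)
    (P : probability T R) (n : nat) (X : 'I_n -> {RV P >-> R}) (w : T) : R :=
  (\sum_(i < n) X i w) / Num.sqrt (\sum_(i < n) X i w ^+ 2).

(* Main.v *)
From HB Require Import structures.
Require Import Defs.
From mathcomp Require Import all_boot all_order all_algebra.
From mathcomp Require Import ring lra.
From mathcomp Require Import all_classical all_reals all_analysis.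
From mathcomp Require Import measurable_realfun.

(* Given |X_1|, ..., |X_n|, the weights p_i = X_i^2 / (X_1^2 + ... + X_n^2)
   determine the conditional 2m-th moment of Z_F as the average over all signs
   of (+- sqrt p_1 ... +- sqrt p_n)^(2m), and this average is Schur-concave in
   p: when p_i and p_j vary with p_i + p_j fixed, it is a polynomial in p_i p_j
   with nonnegative coefficients.  Sampling both |X_i| = a(U_i) and
   |Y_i| = b(U_i) from the same i.i.d. uniform U_i, the monotonicity of a / b
   makes the weights of X majorize those of Y for every value of the U_i, so
   the inequality between conditional moments holds pointwise.  It is strict
   for m >= 2 unless a / b takes the same value at all the U_i. *)

Set Implicit Arguments.
Unset Strict Implicit.
Unset Printing Implicit Defensive.

Import Order.TTheory GRing.Theory Num.Theory.
Import numFieldNormedType.Exports.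

Local Open Scope classical_set_scope.
Local Open Scope ring_scope.

(** * Schur concavity of sign-averaged even powers *)

Definition nneg_poly (R : realType) (q : {poly R}) : Prop :=
  forall i, 0 <= q`_i.

Lemma nneg_polyD (R : realType) (p q : {poly R}) :
  nneg_poly p -> nneg_poly q -> nneg_poly (p + q).
Proof. by move=> p0 q0 i; rewrite coefD addr_ge0. Qed.

Lemma nneg_polyM (R : realType) (p q : {poly R}) :
  nneg_poly p -> nneg_poly q -> nneg_poly (p * q).
Proof. by move=> p0 q0 i; rewrite coefM sumr_ge0// => j _; rewrite mulr_ge0. Qed.

Lemma nneg_polyC (R : realType) (c : R) : 0 <= c -> nneg_poly c%:P.
Proof. by move=> c0 i; rewrite coefC; case: ifP. Qed.

Lemma nneg_polyXn (R : realType) (n : nat) : nneg_poly ('X^n : {poly R}).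
Proof. by move=> i; rewrite coefXn ler0n. Qed.

(** Since (S +- w)^2 = (S^2 + w^2) +- 2 S w, raising m mixes the sum and the difference of the
    powers, so one induction carries both. The term 2 w^(2m) is kept apart because [q] vanishes for
    S = 0; strictness later rests on that term. *)
Lemma even_power_poly (R : realType) (S : R) (m : nat) :
  exists q r : {poly R},
    [/\ nneg_poly q, nneg_poly r,
        forall w, (S + w) ^+ (2 * m) + (S - w) ^+ (2 * m) =
                  2 * (w ^+ 2) ^+ m + q.[w ^+ 2]
      & forall w, (S + w) ^+ (2 * m) - (S - w) ^+ (2 * m) =
                  S * w * r.[w ^+ 2]].
Proof.
elim: m => [|m [q [r [nq nr Eq Er]]]].
  have n0 : nneg_poly (0 : {poly R}) by rewrite -polyC0; exact: nneg_polyC.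
  by exists 0, 0; split=> // w; rewrite muln0 !expr0 horner0; ring.
have nS : nneg_poly (S ^+ 2)%:P by apply: nneg_polyC; exact: sqr_ge0.
have n2 : nneg_poly (2%:P : {poly R}) by apply: nneg_polyC.
have nX := @nneg_polyXn R.
(* ['X] stands for w^2. The product of w^2 and 2 w^(2m) is left out of the new [q], as it is the
   next split-off term. *)
exists ((S ^+ 2)%:P * (2%:P * 'X^m + q) + 'X^1 * q
        + 2%:P * (S ^+ 2)%:P * 'X^1 * r).
exists (((S ^+ 2)%:P + 'X^1) * r + 2%:P * (2%:P * 'X^m + q)).
split; [by repeat (apply: nneg_polyD || apply: nneg_polyM)|
        by repeat (apply: nneg_polyD || apply: nneg_polyM)| |] => w.
all: have -> : (S + w) ^+ (2 * m.+1) =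
       (S ^+ 2 + w ^+ 2 + 2 * S * w) * (S + w) ^+ (2 * m)
     by rewrite mulnS exprD; ring.
all: have -> : (S - w) ^+ (2 * m.+1) =
       (S ^+ 2 + w ^+ 2 - 2 * S * w) * (S - w) ^+ (2 * m)
     by rewrite mulnS exprD; ring.
- transitivity ((S ^+ 2 + w ^+ 2) * ((S + w) ^+ (2 * m) + (S - w) ^+ (2 * m)) +
     2 * S * w * ((S + w) ^+ (2 * m) - (S - w) ^+ (2 * m))); first by ring.
  rewrite Eq Er !(hornerD, hornerM, hornerC, hornerXn) (exprS (w ^+ 2) m).
  by ring.
- transitivity ((S ^+ 2 + w ^+ 2) * ((S + w) ^+ (2 * m) - (S - w) ^+ (2 * m)) +
     2 * S * w * ((S + w) ^+ (2 * m) + (S - w) ^+ (2 * m))); first by ring.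
  by rewrite Eq Er !(hornerD, hornerM, hornerC, hornerXn); ring.
Qed.

(** With A and B the sum and the difference of (c + t)^k and (c - t)^k, the next pair is c A + t B
    and c B + t A, so nonnegativity and monotonicity in t propagate together. *)
Lemma ler_exprDB (R : realType) (c t t' : R) (k : nat) :
  0 <= c -> 0 <= t -> t <= t' ->
  [/\ 0 <= (c + t) ^+ k + (c - t) ^+ k,
      (c + t) ^+ k + (c - t) ^+ k <= (c + t') ^+ k + (c - t') ^+ k,
      0 <= (c + t) ^+ k - (c - t) ^+ k
    & (c + t) ^+ k - (c - t) ^+ k <= (c + t') ^+ k - (c - t') ^+ k].
Proof.
move=> c0 t0 tt'; elim: k => [|k [h1 h2 h3 h4]].
  by rewrite !expr0; split; lra.
rewrite !exprS; move: h1 h2 h3 h4.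
set a := (c + t) ^+ k; set b := (c - t) ^+ k.
set a' := (c + t') ^+ k; set b' := (c - t') ^+ k => h1 h2 h3 h4.
by split; nra.
Qed.

(** Strictness starts at k = 2, where the sum is 2 c^2 + 2 t^2; for k = 0 and k = 1 the sum does not
    depend on t. *)
Lemma ltr_exprDB (R : realType) (c t t' : R) (k : nat) :
  0 < c -> 0 <= t -> t < t' -> (2 <= k)%N ->
  (c + t) ^+ k + (c - t) ^+ k < (c + t') ^+ k + (c - t') ^+ k.
Proof.
move=> c0 t0 tt'; case: k => [//|[//|k]] _; elim: k => [|k ih].
  by rewrite !expr2; nra.
have [h1 h2 h3 h4] := ler_exprDB k.+2 (ltW c0) t0 (ltW tt').
rewrite exprS [(c - t) ^+ _]exprS [(c + t') ^+ _]exprS [(c - t') ^+ _]exprS.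
move: ih h1 h2 h3 h4.
set a := (c + t) ^+ _; set b := (c - t) ^+ _.
set a' := (c + t') ^+ _; set b' := (c - t') ^+ _ => ih h1 h2 h3 h4.
by nra.
Qed.

Lemma ler_horner_DB (R : realType) (q : {poly R}) (c t t' : R) :
  nneg_poly q -> 0 <= c -> 0 <= t -> t <= t' ->
  q.[c + t] + q.[c - t] <= q.[c + t'] + q.[c - t'].
Proof.
move=> nq c0 t0 tt'; rewrite !horner_coef -!big_split /=.
apply: ler_sum => i _; rewrite -!mulrDr; apply: ler_wpM2l => //.
by have [] := ler_exprDB i c0 t0 tt'.
Qed.

Definition sign_quad (R : realType) (m : nat) (S x y : R) (a b : bool) : R :=
  (S + (-1) ^+ a * x + (-1) ^+ b * y) ^+ (2 * m).

Definition sign_quad_sum (R : realType) (m : nat) (S x y : R)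
    (a b : bool) : R :=
  sign_quad m S x y a b + sign_quad m S x y (~~ a) b +
  sign_quad m S x y a (~~ b) + sign_quad m S x y (~~ a) (~~ b).

Lemma sign_quad_sumE (R : realType) (m : nat) (S x y : R) (a b : bool) :
  sign_quad_sum m S x y a b = sign_quad_sum m S x y false false.
Proof. by case: a b => -[]; rewrite /sign_quad_sum /=; ring. Qed.

(* With [x^2 + y^2] held fixed, the sum over the four signs only depends on
   [x * y]: the squares of [x + y] and [x - y] are [c + t] and [c - t] with
   [c = x^2 + y^2] and [t = 2 x y]. *)
Lemma sign_quad_sum_le (R : realType) (m : nat) (S x y x' y' : R) (a b : bool) :
  x ^+ 2 + y ^+ 2 = x' ^+ 2 + y' ^+ 2 -> 0 <= x * y -> x * y <= x' * y' ->
  sign_quad_sum m S x y a b <= sign_quad_sum m S x' y' a b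
  /\ ((2 <= m)%N -> x * y < x' * y' ->
      sign_quad_sum m S x y a b < sign_quad_sum m S x' y' a b).
Proof.
move=> exy xy0 xyle; rewrite !(sign_quad_sumE _ _ _ _ a b).
have [q [r [nq _ Eq _]]] := even_power_poly S m.
(* Opposite sign choices pair up as S +- (u + v) and S +- (u - v), so [Eq] applies with w = u + v
   and w = u - v. *)
have E u v : sign_quad_sum m S u v false false =
    2 * ((u ^+ 2 + v ^+ 2 + 2 * (u * v)) ^+ m +
         (u ^+ 2 + v ^+ 2 - 2 * (u * v)) ^+ m) +
    (q.[u ^+ 2 + v ^+ 2 + 2 * (u * v)] + q.[u ^+ 2 + v ^+ 2 - 2 * (u * v)]).
  have -> : u ^+ 2 + v ^+ 2 + 2 * (u * v) = (u + v) ^+ 2 by ring.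
  have -> : u ^+ 2 + v ^+ 2 - 2 * (u * v) = (u - v) ^+ 2 by ring.
  rewrite mulrDr addrACA -!Eq /sign_quad_sum /sign_quad /=.
  have -> : S + (-1) ^+ 0 * u + (-1) ^+ 0 * v = S + (u + v) by ring.
  have -> : S + (-1) ^+ 1 * u + (-1) ^+ 0 * v = S - (u - v) by ring.
  have -> : S + (-1) ^+ 0 * u + (-1) ^+ 1 * v = S + (u - v) by ring.
  have -> : S + (-1) ^+ 1 * u + (-1) ^+ 1 * v = S - (u + v) by ring.
  by ring.
rewrite !E -exy; set c := x ^+ 2 + y ^+ 2.
have c0 : 0 <= c by rewrite addr_ge0 ?sqr_ge0.
have t0 : 0 <= 2 * (x * y) by rewrite mulr_ge0.
have tt' : 2 * (x * y) <= 2 * (x' * y') by rewrite ler_pM2l.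
have hq := ler_horner_DB nq c0 t0 tt'.
have [_ hm _ _] := ler_exprDB m c0 t0 tt'.
split=> [|m2 xylt]; first by rewrite lerD// ler_pM2l.
rewrite ltr_leD// ltr_pM2l//; apply: ltr_exprDB => //; last by rewrite ltr_pM2l.
have c'0 : 0 < x' * y' by exact: le_lt_trans xylt.
by rewrite /c exy; nra.
Qed.

(** A sum rather than an average: the factor 2^n is common to both sides of every comparison. *)
Definition sign_moment (R : realType) (n m : nat) (e : 'I_n -> R) : R :=
  \sum_(s : {ffun 'I_n -> bool}) (\sum_(k < n) (-1) ^+ s k * e k) ^+ (2 * m).

Definition flip_sign n (i : 'I_n) (s : {ffun 'I_n -> bool}) :
    {ffun 'I_n -> bool} :=
  [ffun k => s k (+) (k == i)].

Lemma flip_signK n (i : 'I_n) : involutive (flip_sign i).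
Proof. by move=> s; apply/ffunP => k; rewrite !ffunE -addbA addbb addbF. Qed.

Lemma sum_flip_sign (R : realType) n (i : 'I_n) (h : {ffun 'I_n -> bool} -> R) :
  \sum_s h (flip_sign i s) = \sum_s h s.
Proof. by rewrite [RHS](reindex_inj (inv_inj (flip_signK i))). Qed.

(** Flipping the sign at [i], at [j], at both or at neither permutes the sign vectors; adding the
    four reindexed sums gives the factor 4 and isolates [e i] and [e j]. *)
Lemma sign_moment_quad (R : realType) n m (e : 'I_n -> R) (i j : 'I_n) :
  i != j ->
  4 * sign_moment m e =
  \sum_(s : {ffun 'I_n -> bool})
     sign_quad_sum m (\sum_(k < n | (k != i) && (k != j)) (-1) ^+ s k * e k)
       (e i) (e j) (s i) (s j).
Proof.
move=> ij; pose h (s : {ffun 'I_n -> bool}) :=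
  (\sum_(k < n) (-1) ^+ s k * e k) ^+ (2 * m).
have hE s : h s = sign_quad m
    (\sum_(k < n | (k != i) && (k != j)) (-1) ^+ s k * e k)
    (e i) (e j) (s i) (s j).
  rewrite /h /sign_quad; congr (_ ^+ _).
  rewrite (bigD1 i)//= (bigD1 j) ?[j == i]eq_sym//=; ring.
transitivity (\sum_s (h s + h (flip_sign i s) + h (flip_sign j s)
    + h (flip_sign i (flip_sign j s)))).
  rewrite !big_split /= !sum_flip_sign.
  rewrite (sum_flip_sign j (fun s => h (flip_sign i s))) sum_flip_sign.
  by rewrite /sign_moment -/h; ring.
apply: eq_bigr => s _; rewrite /sign_quad_sum !hE !ffunE !eqxx.
rewrite [j == i]eq_sym (negbTE ij) /= !addbT !addbF.
have es t : (forall k, k != i -> k != j -> t k = s k) ->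
  \sum_(k < n | (k != i) && (k != j)) (-1) ^+ nat_of_bool (t k) * e k =
  \sum_(k < n | (k != i) && (k != j)) (-1) ^+ nat_of_bool (s k) * e k.
  by move=> ts; apply: eq_bigr => k /andP[ki kj]; rewrite ts.
rewrite (es (flip_sign i s)) ?(es (flip_sign j s))
  ?(es (flip_sign i (flip_sign j s)))//.
all: by move=> k /negbTE ki /negbTE kj; rewrite !ffunE ?ki ?kj ?addbF.
Qed.

(** The square roots have a fixed sum of squares p i + p j and product sqrt (p i p j), so
    [sign_quad_sum_le] applies for every choice of signs. *)
Lemma sign_moment_transfer (R : realType) n m (p p' : 'I_n -> R) (i j : 'I_n) :
  i != j -> (forall k, 0 <= p k) -> (forall k, 0 <= p' k) ->
  (forall k, k != i -> k != j -> p k = p' k) ->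
  p i + p j = p' i + p' j -> p i * p j <= p' i * p' j ->
  sign_moment m (fun k => Num.sqrt (p k))
    <= sign_moment m (fun k => Num.sqrt (p' k))
  /\ ((2 <= m)%N -> p i * p j < p' i * p' j ->
  sign_moment m (fun k => Num.sqrt (p k))
    < sign_moment m (fun k => Num.sqrt (p' k))).
Proof.
move=> ij p0 p'0 pp' sum prod.
pose e k := Num.sqrt (p k); pose e' k := Num.sqrt (p' k).
have es s :
    \sum_(k < n | (k != i) && (k != j)) (-1) ^+ nat_of_bool (s k) * e k =
    \sum_(k < n | (k != i) && (k != j)) (-1) ^+ nat_of_bool (s k) * e' k.
  by apply: eq_bigr => k /andP[ki kj]; rewrite /e /e' pp'.
have H (s : {ffun 'I_n -> bool}) := @sign_quad_sum_le R m
  (\sum_(k < n | (k != i) && (k != j)) (-1) ^+ nat_of_bool (s k) * e k)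
  (e i) (e j) (e' i) (e' j) (s i) (s j).
have h1 : e i ^+ 2 + e j ^+ 2 = e' i ^+ 2 + e' j ^+ 2 by rewrite !sqr_sqrtr.
have h2 : 0 <= e i * e j by rewrite mulr_ge0 ?sqrtr_ge0.
have h3 : e i * e j <= e' i * e' j by rewrite -!sqrtrM// ler_wsqrtr.
have four : 0 < 4 :> R by [].
rewrite -(ler_pM2l four) -[X in _ -> _ -> is_true X](ltr_pM2l four).
rewrite !(sign_moment_quad _ _ ij); split=> [|m2 prodlt].
  by apply: ler_sum => s _; rewrite -es; case: (H s h1 h2 h3).
have h4 : e i * e j < e' i * e' j.
  by rewrite -!sqrtrM// ltr_sqrt// (le_lt_trans _ prodlt)// mulr_ge0.
apply: ltr_sum => [|s _]; last by rewrite -es; case: (H s h1 h2 h3) => _; exact.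
by apply/hasP; exists [ffun=> false]; rewrite // mem_index_enum.
Qed.

Lemma sum_eq_exists_lt (R : realType) n (p p' : 'I_n -> R) :
  \sum_k p k = \sum_k p' k -> (exists k, p k != p' k) -> exists k, p k < p' k.
Proof.
move=> sum [k kne]; apply/not_existsP => H.
have le i : p' i <= p i by rewrite leNgt; apply/negP; exact: H.
have : \sum_i (p i - p' i) = 0 by rewrite sumrB sum subrr.
move/eqP; rewrite psumr_eq0 => [|i _]; last by rewrite subr_ge0.
by move/allP/(_ k (mem_index_enum _)); rewrite /= subr_eq0 (negbTE kne).
Qed.

(* The condition on signs makes [p] majorize [p'], and each step of the
   induction is a transfer from a coordinate [j] with [p' j < p j] to a
   coordinate [i] with [p i < p' i] that makes one more coordinate agree. *)
Lemma sign_moment_majorize (R : realType) n m (p p' : 'I_n -> R) :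
  (forall k, 0 <= p k) -> (forall k, 0 <= p' k) -> \sum_k p k = \sum_k p' k ->
  (forall i j, p i < p' i -> p' j < p j -> p' i <= p' j) ->
  sign_moment m (fun k => Num.sqrt (p k))
    <= sign_moment m (fun k => Num.sqrt (p' k))
  /\ ((2 <= m)%N -> (exists k, p k != p' k) ->
  sign_moment m (fun k => Num.sqrt (p k))
    < sign_moment m (fun k => Num.sqrt (p' k))).
Proof.
move=> + p'0; have [N] := ubnP #|[set k | p k != p' k]%SET|.
elim: N p => // N ih p cardN p0 sum sgn.
have [[k kne]|/forallNP eqp] := pselect (exists k, p k != p' k); last first.
  have -> : p = p' by apply/funext => k; apply/eqP/negPn/negP; exact: eqp.
  by split=> // _ [k]; rewrite eqxx.
have [i lti] : exists i, p i < p' i by apply: sum_eq_exists_lt => //; exists k.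
have [j ltj] : exists j, p' j < p j.
  by apply: sum_eq_exists_lt; [|exists k; rewrite eq_sym].
have ij : i != j by apply/eqP => eij; move: lti ltj; rewrite eij; lra.
have leij := sgn _ _ lti ltj.
(* The smaller of the two gaps: neither coordinate passes its target and at least one reaches it. *)
pose d := Num.min (p' i - p i) (p j - p' j).
have d0 : 0 < d by rewrite lt_min !subr_gt0 lti ltj.
have di : d <= p' i - p i by rewrite ge_min lexx.
have dj : d <= p j - p' j by rewrite ge_min lexx orbT.
pose p1 k := if k == i then p i + d else if k == j then p j - d else p k.
have p1i : p1 i = p i + d by rewrite /p1 eqxx.
have p1j : p1 j = p j - d by rewrite /p1 eq_sym (negbTE ij) eqxx.
have p1k l : l != i -> l != j -> p1 l = p l.
  by rewrite /p1 => /negbTE -> /negbTE ->.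
have p10 l : 0 <= p1 l.
  have [->|li] := eqVneq l i; first by rewrite p1i addr_ge0// ltW.
  have [->|lj] := eqVneq l j; last by rewrite p1k.
  by rewrite p1j; have := p'0 j; lra.
have [le1 lt1] : sign_moment m (fun k => Num.sqrt (p k)) <=
    sign_moment m (fun k => Num.sqrt (p1 k))
  /\ ((2 <= m)%N -> p i * p j < p1 i * p1 j ->
  sign_moment m (fun k => Num.sqrt (p k))
    < sign_moment m (fun k => Num.sqrt (p1 k))).
  apply: (@sign_moment_transfer R n m p p1 i j) => //.
  - by move=> l li lj; rewrite p1k.
  - by rewrite p1i p1j; ring.
  - by rewrite p1i p1j; nra.
(* The gain is d (p j - d - p i), positive because p i < p' i <= p' j <= p j - d. *)
have prodlt : p i * p j < p1 i * p1 j by rewrite p1i p1j; nra.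
have sum1 : \sum_k p1 k = \sum_k p' k.
  rewrite -sum (bigD1 i)//= (bigD1 j) ?[j == i]eq_sym//= [RHS](bigD1 i)//=.
  rewrite [X in _ = _ + X](bigD1 j) ?[j == i]eq_sym//= p1i p1j.
  have -> : \sum_(l < n | (l != i) && (l != j)) p1 l =
      \sum_(l < n | (l != i) && (l != j)) p l.
    by apply: eq_bigr => l /andP[li lj]; rewrite p1k.
  by ring.
(* No coordinate crosses its target, so the sign condition passes from [p] to [p1]. *)
have lt_p1 l : p1 l < p' l -> p l < p' l.
  have [-> //|li] := eqVneq l i.
  by have [->|lj] := eqVneq l j; [rewrite p1j; lra|rewrite p1k].
have gt_p1 l : p' l < p1 l -> p' l < p l.
  have [->|li] := eqVneq l i; first by rewrite p1i; lra.
  by have [-> //|lj] := eqVneq l j; rewrite p1k.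
have card1 : (#|[set k | p1 k != p' k]%SET| < N)%N.
  rewrite -ltnS (leq_ltn_trans _ cardN)//.
  apply: proper_card; rewrite properE; apply/andP; split.
    apply/fintype.subsetP => l; rewrite !inE; have [->|li] := eqVneq l i.
      by move=> _; rewrite lt_eqF.
    have [->|lj] := eqVneq l j; first by move=> _; rewrite gt_eqF.
    by rewrite p1k.
  apply/negP => /fintype.subsetP sub.
  have /eqP ni : p1 i != p' i by have := sub i; rewrite !inE lt_eqF//; exact.
  have /eqP nj : p1 j != p' j.
    by have := sub j; rewrite !inE [p j == _]gt_eqF//; exact.
  rewrite p1i in ni; rewrite p1j in nj.
  by move: ni nj; rewrite /d; case: leP; lra.
(* The first transfer is already strict, so the weak inequality suffices for the rest. *)
have [le2 _] := ih p1 card1 p10 sum1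
  (fun a b ha hb => sgn a b (lt_p1 a ha) (gt_p1 b hb)).
split=> [|m2 _]; first exact: le_trans le2.
exact: lt_le_trans (lt1 m2 prodlt) le2.
Qed.

(** * Self-normalized sums of fixed vectors under sign changes *)

Definition self_norm (R : realType) (n : nat) (x : 'I_n -> R) : R :=
  (\sum_(i < n) x i) / Num.sqrt (\sum_(i < n) x i ^+ 2).

(** Cauchy-Schwarz against the all-ones vector, read off from the nonnegative dispersion of the x i
    around their mean. *)
Lemma sqr_sum_le (R : realType) n (x : 'I_n -> R) :
  (\sum_i x i) ^+ 2 <= n%:R * \sum_i x i ^+ 2.
Proof.
case: n x => [|n] x; first by rewrite !big_ord0 expr0n mulr0.
set S := \sum_i x i; set N := \sum_i _.
have : 0 <= \sum_i (n.+1%:R * x i - S) ^+ 2.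
  by apply: sumr_ge0 => i _; exact: sqr_ge0.
have -> : \sum_i (n.+1%:R * x i - S) ^+ 2 =
    n.+1%:R * (n.+1%:R * N - S ^+ 2).
  transitivity (\sum_i (n.+1%:R ^+ 2 * x i ^+ 2 - (2 * n.+1%:R * S) * x i
                          + S ^+ 2)).
    by apply: eq_bigr => i _; ring.
  rewrite !big_split/= sumrN -!mulr_sumr -/N -/S sumr_const card_ord.
  by rewrite -mulr_natl; ring.
by rewrite pmulr_rge0 ?ltr0n// subr_ge0.
Qed.

Lemma self_norm_sqr_le (R : realType) n (x : 'I_n -> R) :
  self_norm x ^+ 2 <= n%:R.
Proof.
rewrite /self_norm expr_div_n sqr_sqrtr; last first.
  by apply: sumr_ge0 => i _; exact: sqr_ge0.
have := sqr_sum_le x; set N := \sum_i x i ^+ 2.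
have : 0 <= N by apply: sumr_ge0 => i _; exact: sqr_ge0.
rewrite le_eqVlt => /predU1P[<- _|N0]; first by rewrite invr0 mulr0.
by rewrite ler_pdivrMr.
Qed.

Definition sign_sum (R : realType) (n m : nat) (x : 'I_n -> R) : R :=
  \sum_(s : {ffun 'I_n -> bool})
    self_norm (fun i => (-1) ^+ s i * x i) ^+ (2 * m).

(** The signs of [x] are absorbed into [s] by an exclusive or, which permutes the sign vectors. *)
Lemma sign_sum_norm (R : realType) n m (x : 'I_n -> R) :
  sign_sum m (fun i => `|x i|) = sign_sum m x.
Proof.
pose f (s : {ffun 'I_n -> bool}) : {ffun 'I_n -> bool} :=
  [ffun i => s i (+) (x i < 0)].
have fK : involutive f.
  by move=> s; apply/ffunP => i; rewrite !ffunE -addbA addbb addbF.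
rewrite /sign_sum (reindex_inj (inv_inj fK)); apply: eq_bigr => s _.
congr (self_norm _ ^+ _).
apply/funext => i; rewrite ffunE signr_addb -mulrA; congr (_ * _).
case: ltP => [x0|x0]; first by rewrite ltr0_norm// mulN1r opprK.
by rewrite ger0_norm// mul1r.
Qed.

Lemma sign_sumE (R : realType) n m (x : 'I_n -> R) : (forall i, 0 <= x i) ->
  sign_sum m x = sign_moment m (fun i => Num.sqrt (x i ^+ 2 / \sum_j x j ^+ 2)).
Proof.
move=> x0; rewrite /sign_sum /sign_moment; apply: eq_bigr => s _.
congr (_ ^+ _).
rewrite /self_norm mulr_suml.
under [X in Num.sqrt X]eq_bigr do rewrite exprMn sqrr_sign mul1r.
apply: eq_bigr => i _; rewrite -mulrA; congr (_ * _).
rewrite sqrtrM ?sqr_ge0// sqrtr_sqr ger0_norm// sqrtrV// sumr_ge0// => j _.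
exact: sqr_ge0.
Qed.

(** With A and B the sums of squares, the weight of x at k is below that of y exactly when (x k / y
    k)^2 < A / B. A coordinate below its target thus has a smaller ratio than one above it, and the
    hypothesis on ratios yields the sign condition of [sign_moment_majorize]. *)
Lemma sign_sum_le (R : realType) n m (x y : 'I_n -> R) :
  (forall i, 0 < x i) -> (forall i, 0 < y i) ->
  (forall i j, x i / y i < x j / y j -> y i <= y j) ->
  sign_sum m x <= sign_sum m y
  /\ ((2 <= m)%N -> (exists i j, x i / y i != x j / y j) ->
      sign_sum m x < sign_sum m y).
Proof.
case: n x y => [|n] x y x0 y0 xy.
  split; last by move=> _ [[]].
  by rewrite /sign_sum; apply: ler_sum => s _; rewrite /self_norm !big_ord0.
have sum0 (z : 'I_n.+1 -> R) : (forall i, 0 < z i) -> 0 < \sum_i z i ^+ 2.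
  move=> z0; rewrite (bigD1 ord0)//= ltr_pwDl ?exprn_gt0//.
  by apply: sumr_ge0 => i _; exact: sqr_ge0.
have A0 := sum0 x x0; have B0 := sum0 y y0.
rewrite !sign_sumE; try by move=> i; rewrite ltW.
set A := \sum_j x j ^+ 2; set B := \sum_j y j ^+ 2.
have p0 (z : 'I_n.+1 -> R) C k : 0 < C -> 0 <= z k ^+ 2 / C.
  by move=> C0; rewrite divr_ge0 ?sqr_ge0// ltW.
have sum1 (z : 'I_n.+1 -> R) : 0 < \sum_j z j ^+ 2 ->
    \sum_k (z k ^+ 2 / \sum_j z j ^+ 2) = 1.
  by move=> C0; rewrite -mulr_suml mulfV// gt_eqF.
have pE k : x k ^+ 2 / A = (x k / y k) ^+ 2 * (B / A) * (y k ^+ 2 / B).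
  by field; rewrite !gt_eqF.
have p'E k : y k ^+ 2 / B = A / B * (B / A) * (y k ^+ 2 / B).
  by field; rewrite !gt_eqF.
have lowE k : (x k ^+ 2 / A < y k ^+ 2 / B) = ((x k / y k) ^+ 2 < A / B).
  rewrite pE [X in _ < X]p'E ltr_pM2r ?divr_gt0 ?exprn_gt0//.
  by rewrite ltr_pM2r// divr_gt0.
have highE k : (y k ^+ 2 / B < x k ^+ 2 / A) = (A / B < (x k / y k) ^+ 2).
  rewrite pE [X in X < _]p'E ltr_pM2r ?divr_gt0 ?exprn_gt0//.
  by rewrite ltr_pM2r// divr_gt0.
have r0 k : 0 <= x k / y k by rewrite ltW// divr_gt0.
have sgn i j : x i ^+ 2 / A < y i ^+ 2 / B -> y j ^+ 2 / B < x j ^+ 2 / A ->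
    y i ^+ 2 / B <= y j ^+ 2 / B.
  rewrite lowE highE => hi hj; rewrite ler_pM2r ?invr_gt0//.
  rewrite ler_sqr ?nnegrE; [|by rewrite ltW..].
  apply: xy; rewrite -ltr_sqr ?nnegrE//; exact: lt_trans hi hj.
have [le lt] := @sign_moment_majorize R n.+1 m (fun k => x k ^+ 2 / A)
  (fun k => y k ^+ 2 / B) (fun k => p0 x A k A0) (fun k => p0 y B k B0)
  (etrans (sum1 x A0) (esym (sum1 y B0))) sgn.
split=> // m2 [i [j rij]]; apply: lt => //; apply: contrapT => /forallNP E.
(* If all weights agree, every squared ratio is A / B, against the two different ratios. *)
have rE k : (x k / y k) ^+ 2 = A / B.
  by apply/eqP; rewrite eq_le !leNgt -lowE -highE; have /negP := E k;
    rewrite negbK => /eqP ->; rewrite ltxx.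
by move/negP: rij; apply; rewrite -(@eqrXn2 _ 2)// !rE.
Qed.

(** * Joint laws of independent families *)

Definition box d (T : measurableType d) n (A : 'I_n -> set T) :
    set (n.-tuple T) :=
  [set t | forall i, A i (tnth t i)].

Definition boxes d (T : measurableType d) n : set (set (n.-tuple T)) :=
  [set box A | A in [set A | forall i, measurable (A i)]].

Lemma measurable_box d (T : measurableType d) n (A : 'I_n -> set T) :
  (forall i, measurable (A i)) -> measurable (box A).
Proof.
move=> mA.
have -> : box A = \bigcap_(i in [set: 'I_n]) ((@tnth n T ^~ i) @^-1` A i).
  by apply/seteqP; split=> t /= h i => [_|]; exact: h.
apply: fin_bigcap_measurable => // i _.
by rewrite -[X in measurable X]setTI; exact: measurable_tnth.
Qed.

(** A preimage under one projection is a box whose other sides are full, so boxes generate the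
    product sigma-algebra. *)
Lemma measurable_tupleE d (T : measurableType d) n :
  @measurable _ (n.-tuple T) = <<s @boxes d T n >>.
Proof.
apply/seteqP; split.
  apply: smallest_sub; first exact: smallest_sigma_algebra.
  rewrite -bigcup_seq => A [i _ [B mB <-]]; apply: sub_sigma_algebra.
  exists (fun j => if j == i then B else setT) => [j|]; first by case: ifP.
  rewrite setTI; apply/seteqP; split=> t /=; rewrite /box/=.
    by move=> /(_ i); rewrite eqxx.
  by move=> Bt j; case: eqP => [->|].
apply: smallest_sub; first exact: sigma_algebra_measurable.
by move=> _ [A mA <-]; exact: measurable_box.
Qed.

Lemma setI_closed_boxes d (T : measurableType d) n : setI_closed (@boxes d T n).
Proof.
move=> _ _ [A mA <-] [B mB <-]; exists (fun i => A i `&` B i) => [i|].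
  exact: measurableI.
apply/seteqP; split=> t /=; rewrite /box/=.
  by move=> h; split=> i; case: (h i).
by move=> [hA hB] i; split.
Qed.

(** Only measurable boxes are compared: they form a generating pi-system, which for measurable
    families determines the joint law. *)
Definition joint_law_eq d (T : measurableType d) d' (T' : measurableType d')
    d1 (V : measurableType d1) (R : realType)
    (P : probability T R) (Q : probability T' R) n
    (X : 'I_n -> T -> V) (Y : 'I_n -> T' -> V) : Prop :=
  forall A : 'I_n -> set V, (forall i, measurable (A i)) ->
    P (\bigcap_i (X i @^-1` A i)) = Q (\bigcap_i (Y i @^-1` A i)).

Lemma measurable_mktuple d (T : measurableType d) d1 (V : measurableType d1) n
    (X : 'I_n -> T -> V) : (forall i, measurable_fun setT (X i)) ->
  measurable_fun [set: T] (fun w => [tuple X i w | i < n]).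
Proof.
move=> mX; apply/measurable_fun_tnthP => i.
by apply: eq_measurable_fun (mX i) => w _ /=; rewrite tnth_mktuple.
Qed.

(** The image measures on tuples agree on boxes, hence everywhere by uniqueness on a generating
    pi-system; both integrals are then taken against one law. *)
Lemma joint_law_integral d (T : measurableType d) d' (T' : measurableType d')
    d1 (V : measurableType d1) (R : realType)
    (P : probability T R) (Q : probability T' R) n
    (X : 'I_n -> T -> V) (Y : 'I_n -> T' -> V) (f : n.-tuple V -> \bar R) :
  (forall i, measurable_fun setT (X i)) ->
  (forall i, measurable_fun setT (Y i)) ->
  joint_law_eq P Q X Y -> measurable_fun setT f -> (forall t, 0 <= f t)%E ->
  (\int[P]_w f [tuple X i w | i < n] = \int[Q]_w f [tuple Y i w | i < n])%E.
Proof.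
move=> mX mY XY mf f0.
pose X' : T -> n.-tuple V := fun w => [tuple X i w | i < n].
pose Y' : T' -> n.-tuple V := fun w => [tuple Y i w | i < n].
have mX' := measurable_mktuple mX; have mY' := measurable_mktuple mY.
pose HX := isMeasurableFun.Build _ _ _ _ X' mX'.
pose HY := isMeasurableFun.Build _ _ _ _ Y' mY'.
pose X1 : {mfun T >-> n.-tuple V} := HB.pack X' HX.
pose Y1 : {mfun T' >-> n.-tuple V} := HB.pack Y' HY.
transitivity (\int[distribution P X1]_t f t)%E.
  by rewrite ge0_integral_distribution.
transitivity (\int[distribution Q Y1]_t f t)%E; last first.
  by rewrite ge0_integral_distribution.
apply: eq_measure_integral => A mA _.
apply: (measure_unique (@boxes d1 V n) (fun=> setT)) => //.
- exact: measurable_tupleE.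
- exact: setI_closed_boxes.
- move=> _; exists (fun=> setT) => //; by apply/seteqP; split.
- exact: bigcup_const.
- move=> _ [B mB <-]; rewrite /distribution /pushforward /=.
  have := XY B mB; congr (P _ = Q _).
  + apply/seteqP; split=> w /= h i => [|_];
      by have := h i; rewrite /= tnth_mktuple; auto.
  + apply/seteqP; split=> w /= h i => [|_];
      by have := h i; rewrite /= tnth_mktuple; auto.
- by move=> _; rewrite (le_lt_trans (probability_le1 _ _)) ?ltry.
Qed.

(** Built by iterated binary products; it supplies the single uniform sample that drives both
    quantile functions. *)
Lemma exists_iid d (V : measurableType d) (R : realType) (mu : probability V R)
    n :
  exists d' (T : measurableType d') (P : probability T R) (U : 'I_n -> T -> V),
    (forall i, measurable_fun setT (U i)) /\
    forall A : 'I_n -> set V, (forall i, measurable (A i)) ->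
      (P (\bigcap_i (U i @^-1` A i)) = \prod_i mu (A i))%E.
Proof.
elim: n => [|n [d' [T [P [U [mU PU]]]]]].
  exists d, V, mu, (fun _ => id); split => [[]//|A mA].
  rewrite big_ord0 -(probability_setT mu); congr (mu _).
  by apply/seteqP; split=> // t _ [].
pose P1 : probability (V * T)%type R := (mu \x P)%E.
exists _, _, P1.
exists (fun i => if unlift ord0 i is Some j then U j \o snd else fst).
split=> [i|A mA].
  by case: unliftP => [j|] _ //; apply: measurableT_comp.
rewrite big_ord_recl -(PU (fun i => A (lift ord0 i)))//.
have mP : measurable (\bigcap_i (U i @^-1` A (lift ord0 i))).
  apply: fin_bigcap_measurable => // i _.
  by rewrite -[X in measurable X]setTI; exact: mU.
rewrite -[RHS]product_measure1E//; congr (P1 _).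
apply/seteqP; split=> -[v t] /= h.
  split=> [|i _]; first by have := h ord0 I; rewrite unlift_none.
  by have := h (lift ord0 i) I; rewrite liftK.
move=> i _; case: unliftP => [j ->|->] /=; first exact: h.2.
exact: h.1.
Qed.

(** * Quantile functions *)

Section quantile_theory.
Context d (T : measurableType d) (R : realType) (P : probability T R).
Variable X : {RV P >-> R}.

Let upper (u : R) := [set x : R | (u%:E <= cdf X x)%E].

Lemma quantile_nonempty (u : R) : u < 1 -> upper u !=set0.
Proof.
move=> u1; apply/set0P/negP => /eqP E.
have : (1 <= u%:E)%E.
  apply: (cvge_le _ (cvg_cdfy1 X)); apply: nearW => x.
  rewrite leNgt; apply/negP => /ltW h.
  by have : upper u x by []; rewrite E.
by rewrite lee_fin leNgt u1.
Qed.

Lemma quantile_has_lbound (u : R) : 0 < u -> has_lbound (upper u).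
Proof.
move=> u0; apply: contrapT => /forallNP E.
have : (u%:E <= 0)%E.
  apply: (cvge_ge _ (cvg_cdfNy0 X)); apply: nearW => x.
  have /existsNP[y /not_implyP[uy /negP]] := E x.
  rewrite -ltNge => yx; apply: le_trans uy _.
  exact/cdf_nondecreasing/ltW.
by rewrite lee_fin leNgt u0.
Qed.

(** The Galois connection between quantile and cdf. Right continuity of the cdf makes the infimum
    attained: every point to its right lies above some member of the set. *)
Lemma quantile_le (u x : R) : 0 < u -> u < 1 ->
  (quantile X u <= x) = (u%:E <= cdf X x)%E.
Proof.
move=> u0 u1; have ne := quantile_nonempty u1.
have lb := quantile_has_lbound u0.
apply/idP/idP => [qx|ux]; last exact: ge_inf.
apply: le_trans (cdf_nondecreasing X qx).
apply: (cvge_ge (F := (quantile X u)^'+) (f := cdf X)) => //; last first.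
  exact: cdf_right_continuous.
near=> y.
have qy : quantile X u < y by near: y; exact: nbhs_right_gt.
have d0 : 0 < y - quantile X u by rewrite subr_gt0.
have [e ue elt] := inf_adherent d0 (conj ne lb).
apply: le_trans ue _; apply: cdf_nondecreasing.
by rewrite ltW// (lt_le_trans elt)// -/(quantile X u) addrC subrK.
Unshelve. all: by end_near. Qed.

Lemma quantile_nondecreasing (u v : R) : 0 < u -> u <= v -> v < 1 ->
  quantile X u <= quantile X v.
Proof.
move=> u0 uv v1; rewrite quantile_le ?(le_lt_trans uv)//.
apply: (@le_trans _ _ v%:E); first by rewrite lee_fin.
by rewrite -quantile_le// (lt_le_trans u0).
Qed.

End quantile_theory.

(** * Uniform variables and the quantile transform *)

Section uniform_sampling.
Context (R : realType).

Definition unif : probability (measurableTypeR R) R := uniform_prob (@ltr01 R).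

(* Points outside of ]0, 1[, a null set for [unif], are moved inside because
   [quantile] takes junk values there. *)
Definition clip01 (u : measurableTypeR R) : R := if 0 < u < 1 then u else 2^-1.

Lemma clip01_itv u : 0 < clip01 u < 1.
Proof. by rewrite /clip01; case: ifPn => // _; lra. Qed.

Lemma measurable_clip01 : measurable_fun setT clip01.
Proof.
apply: measurable_fun_ifT => //.
by apply: measurable_and; apply: measurable_fun_ltr.
Qed.

(** The density is 1 on [0, 1] and the endpoints are null; on the open interval [clip01] is the
    identity. *)
Lemma unifE (A : set (measurableTypeR R)) : measurable A ->
  unif A = lebesgue_measure (A `&` `]0, 1[%classic).
Proof.
move=> mA; rewrite /unif /= /uniform_prob integral_uniform_pdf.
rewrite (eq_integral (fun=> 1%:E)); last first.
  move=> x; rewrite inE/= /uniform_pdf in_itv/= => -[_ ->].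
  by rewrite subr0 invr1.
have mA01 : measurable (A `&` `[0, 1]%classic) by exact: measurableI.
rewrite integral_cst// mul1e.
have mB : measurable (A `&` `]0, 1[%classic) by exact: measurableI.
apply/eqP; rewrite eq_le; apply/andP; split; last first.
  by rewrite le_measure ?inE//; apply: setIS; exact: subset_itv_oo_cc.
have mS : measurable ([set (0 : R)] `|` [set 1]) by exact: measurableU.
have S0 : lebesgue_measure ([set (0 : R)] `|` [set 1]) = 0%E.
  by rewrite measureU0//; exact: lebesgue_measure_set1.
rewrite -[leRHS](measureU0 mB mS S0) le_measure ?inE//.
  exact: measurableU.
move=> x [Ax /=]; rewrite in_itv/= => /andP[x0 x1].
have [->|x0'] := eqVneq x 0; first by right; left.
have [->|x1'] := eqVneq x 1; first by right; right.
by left; split=> //=; rewrite in_itv/= !lt_neqAle x0 x1 x1' eq_sym x0'.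
Qed.

Lemma unif_clip01E (A : set R) : measurable A ->
  unif (clip01 @^-1` A) = lebesgue_measure (A `&` `]0, 1[%classic).
Proof.
move=> mA; rewrite unifE; last first.
  by rewrite -[X in measurable X]setTI; exact: measurable_clip01.
congr (lebesgue_measure _); apply/seteqP.
split=> x [] /= + x01; rewrite /clip01.
all: by have := x01; rewrite in_itv/= => ->.
Qed.

End uniform_sampling.

Section quantile_transform.
Context d (T : measurableType d) (R : realType) (P : probability T R).
Variable X : {RV P >-> R}.

Let q (u : measurableTypeR R) : R := quantile X (clip01 u).

Let p x := fine (cdf X x).

Let q_gt x : q @^-1` `]x, +oo[ = @clip01 R @^-1` `]p x, +oo[.
Proof.
have E u : (q u <= x) = (clip01 u <= p x).
  have /andP[u0 u1] := clip01_itv u.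
  by rewrite quantile_le// -lee_fin fineK// fin_num_measure.
by apply/seteqP; split=> u /=; rewrite !in_itv/= !andbT !ltNge E.
Qed.

Lemma measurable_quantile_clip01 : measurable_fun setT q.
Proof.
apply: (measurability (@RGenOInfty.G R)); first exact: RGenOInfty.measurableE.
move=> _ [_ [x ->] <-]; rewrite setTI q_gt -[X in measurable X]setTI.
exact: measurable_clip01.
Qed.

(** Inverse transform sampling: by [quantile_le] both measures give the ray above x the mass 1 - p
    x, and these rays form a generating pi-system. *)
Lemma quantile_transform (A : set R) : measurable A ->
  unif R (q @^-1` A) = P (X @^-1` A).
Proof.
pose Hq := isMeasurableFun.Build _ _ _ _ q measurable_quantile_clip01.
pose q1 : {mfun measurableTypeR R >-> R} := HB.pack q Hq.
move=> mA.
rewrite -[LHS]/(distribution (unif R) q1 A) -[RHS]/(distribution P X A).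
apply: (measure_unique (@RGenOInfty.G R)
  (fun n => `]- n%:R, +oo[%classic)) => //.
- exact: RGenOInfty.measurableE.
- move=> _ _ [x ->] [y ->]; exists (Num.max x y).
  by apply/seteqP; split=> z /=; rewrite !in_itv/= !andbT gt_max => /andP.
- by move=> n; exists (- n%:R).
- rewrite -subTset => x _; exists (Num.truncn `|x|).+1 => //=.
  rewrite in_itv/= andbT ltrNl (le_lt_trans _ (truncnS_gt _))//.
  by rewrite -normrN ler_norm.
- move=> _ [x ->]; rewrite /distribution /pushforward /= q_gt unif_clip01E//.
  have px0 : 0 <= p x by rewrite fine_ge0.
  have pxE : (p x)%:E = cdf X x by rewrite fineK// fin_num_measure.
  have px1 : p x <= 1 by rewrite -lee_fin pxE cdf_le1.
  transitivity (1 - p x)%:E.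
    have -> : `]p x, +oo[%classic `&` `]0, 1[%classic = `]p x, 1[%classic.
      apply/seteqP; split=> z /=; rewrite !in_itv/= ?andbT.
        by move=> [-> /andP[_ ->]].
      by move=> /andP[pz ->]; rewrite pz (le_lt_trans px0).
    (* When the interval ]p x, 1[ is empty, p x = 1 and both sides are 0. *)
    rewrite lebesgue_measure_itv/= lte_fin; case: ltP => [_|h]; first by [].
    by rewrite (@le_anti _ _ (p x) 1) ?px1// subrr.
  rewrite EFinB pxE -[RHS]/(distribution P X `]x, +oo[%classic).
  have -> : `]x, +oo[%classic = ~` `]-oo, x]%classic by rewrite setCitvl.
  by rewrite probability_setC.
- by move=> n; rewrite (le_lt_trans (probability_le1 _ _)) ?ltry.
Qed.

End quantile_transform.

(** * Moments of self-normalized sums *)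

Lemma measurable_self_norm d (T : measurableType d) (R : realType) n
    (X : 'I_n -> T -> R) : (forall i, measurable_fun setT (X i)) ->
  measurable_fun [set: T] (fun w => self_norm (X^~ w)).
Proof.
move=> mX; apply: measurable_funM; first exact: measurable_sum.
(* The inverse becomes a real power, a measurable function; both conventions give 0 at 0. *)
have -> : (fun w => (Num.sqrt (\sum_i X i w ^+ 2))^-1) =
    (fun w => (Num.sqrt (\sum_i X i w ^+ 2)) `^ (-1)).
  by apply/funext => w; rewrite powR_inv1// sqrtr_ge0.
apply: (measurableT_comp (@measurable_powR R (-1))).
apply: (measurableT_comp (continuous_measurable_fun (@sqrt_continuous R))).
by apply: measurable_sum => i; exact: measurable_funX.
Qed.

Lemma measurable_sign_sum d (T : measurableType d) (R : realType) n m
    (X : 'I_n -> T -> R) : (forall i, measurable_fun setT (X i)) ->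
  measurable_fun [set: T] (fun w => sign_sum m (X^~ w)).
Proof.
move=> mX; apply: measurable_sum => s; apply: measurable_funX.
apply: (@measurable_self_norm _ _ _ _ (fun i w => (-1) ^+ s i * X i w)) => i.
exact: measurable_funM.
Qed.

Lemma sign_sum_ge0 (R : realType) n m (x : 'I_n -> R) : 0 <= sign_sum m x.
Proof. by apply: sumr_ge0 => s _; rewrite exprM exprn_ge0// sqr_ge0. Qed.

(** * Sign symmetrization and quantile representation of i.i.d. samples *)

Section iid.
Context d (T : measurableType d) (R : realType) (P : probability T R).
Context n (X : 'I_n -> {RV P >-> R}) (F : probability R R).
Hypothesis iidX : iid_sample X F.

Lemma iid_sample_box (A : 'I_n -> set R) : (forall i, measurable (A i)) ->
  (P (\bigcap_i (X i @^-1` A i)) = \prod_i F (A i))%E.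
Proof.
move=> mA; have [indep law] := iidX.
have := indep [set: 'I_n]%SET A mA.
have -> : [set` [set: 'I_n]%SET] = [set: 'I_n].
  by apply/seteqP; split=> i //= _; rewrite inE.
move=> ->; rewrite big_mkcond; apply: eq_bigr => i _.
by rewrite inE; exact: law.
Qed.

(** By symmetry, reflecting the sides of a box at the flipped coordinates preserves their masses
    under [F]. *)
Lemma joint_law_sign (s : 'I_n -> bool) : symmetric_law F ->
  joint_law_eq P P X (fun i w => (-1) ^+ s i * X i w).
Proof.
move=> symF A mA; rewrite iid_sample_box//.
pose A' i := if s i then -%R @^-1` A i else A i.
have mA' i : measurable (A' i).
  rewrite /A'; case: ifP => // _; rewrite -[X in measurable X]setTI.
  by apply: oppr_measurable => //.
transitivity (\prod_i F (A' i))%E.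
  by apply: eq_bigr => i _; rewrite /A'; case: ifP => // _; rewrite symF.
rewrite -iid_sample_box//; congr (P _); apply: eq_bigcapr => i _.
rewrite /A'; apply/seteqP.
by split=> w /=; case: (s i); rewrite /= ?mulN1r ?mul1r.
Qed.

Lemma joint_law_abs_quantile d' (T' : measurableType d') (Q : probability T' R)
    (U : 'I_n -> T' -> measurableTypeR R) :
  (forall A, (forall i, measurable (A i)) ->
     (Q (\bigcap_i (U i @^-1` A i)) = \prod_i unif R (A i))%E) ->
  joint_law_eq P Q (fun i w => `|X i w|)
    (fun i w => abs_quantile F (clip01 (U i w))).
Proof.
move=> QU A mA.
have mN i : measurable ((@Num.norm R R) @^-1` A i).
  by rewrite -[X in measurable X]setTI; apply: normr_measurable => //; exact: mA.
rewrite (iid_sample_box mN).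
pose q := (fun u => abs_quantile F (clip01 u)) : measurableTypeR R -> R.
have mq : measurable_fun setT q by exact: measurable_quantile_clip01.
have mqA i : measurable (q @^-1` A i).
  by rewrite -[X in measurable X]setTI; exact: mq.
rewrite [RHS](QU (fun i => q @^-1` A i))//.
by apply: eq_bigr => i _; apply/esym; exact: quantile_transform.
Qed.

(** Each copy of the moment on the left is matched with one sign vector, which leaves the joint law
    unchanged. The sum over signs depends on the absolute values only, and these are replaced by
    quantiles of uniforms. *)
Lemma expectation_sign_sum d' (T' : measurableType d') (Q : probability T' R)
    (U : 'I_n -> T' -> measurableTypeR R) m :
  symmetric_law F -> (forall i, measurable_fun setT (U i)) ->
  (forall A, (forall i, measurable (A i)) ->
     (Q (\bigcap_i (U i @^-1` A i)) = \prod_i unif R (A i))%E) ->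
  (\sum_(s : {ffun 'I_n -> bool})
     'E_P[(fun w => self_normalized_sum X w ^+ (2 * m))%R] =
   \int[Q]_w (sign_sum m (fun i => abs_quantile F (clip01 (U i w))))%:E)%E.
Proof.
move=> symF mU QU.
have mX i : measurable_fun setT (X i) by [].
have tnthE (V : Type) (x : 'I_n -> V) : tnth [tuple x i | i < n] = x.
  by apply/funext => i; rewrite tnth_mktuple.
pose f (t : n.-tuple R) := (self_norm (tnth t) ^+ (2 * m))%:E.
pose g (t : n.-tuple R) := (sign_sum m (tnth t))%:E.
have mt i : measurable_fun setT (fun t : n.-tuple R => tnth t i).
  exact: measurable_tnth.
have mf : measurable_fun setT f.
  apply/measurable_EFinP; apply: measurable_funX.
  exact: (measurable_self_norm mt).
have mg : measurable_fun setT g.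
  by apply/measurable_EFinP; exact: (measurable_sign_sum m mt).
have f0 t : (0 <= f t)%E by rewrite lee_fin exprM exprn_ge0// sqr_ge0.
have g0 t : (0 <= g t)%E by rewrite lee_fin sign_sum_ge0.
have msX (s : {ffun 'I_n -> bool}) i :
    measurable_fun setT (fun w => (-1) ^+ s i * X i w).
  exact: measurable_funM.
transitivity (\sum_(s : {ffun 'I_n -> bool}) \int[P]_w
    (self_norm (fun i => (-1) ^+ s i * X i w) ^+ (2 * m))%:E)%E.
  apply: eq_bigr => s _; rewrite unlock.
  have := joint_law_integral mX (msX s) (joint_law_sign s symF) mf f0.
  rewrite /f; under [in LHS]eq_integral do rewrite tnthE.
  by under [in RHS]eq_integral do rewrite tnthE.
transitivity (\int[P]_w (sign_sum m (fun i => `|X i w|))%:E)%E.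
  rewrite -ge0_integral_sum//=.
  - by apply: eq_integral => w _; rewrite sign_sum_norm sumEFin.
  - move=> s; apply/measurable_EFinP; apply: measurable_funX.
    exact: (measurable_self_norm (msX s)).
  - by move=> s w _; rewrite lee_fin exprM exprn_ge0// sqr_ge0.
have mnX i : measurable_fun setT (fun w => `|X i w|) by exact: measurableT_comp.
have mq i : measurable_fun setT (fun w => abs_quantile F (clip01 (U i w))).
  exact: (measurableT_comp (measurable_quantile_clip01 _) (mU i)).
have := joint_law_integral mnX mq (joint_law_abs_quantile QU) mg g0.
rewrite /g; under [in LHS]eq_integral do rewrite tnthE.
by under [in RHS]eq_integral do rewrite tnthE.
Qed.

End iid.

(** By [quantile_le], positivity says that the cdf of the absolute value at 0, which is the mass of
    the atom at zero, is below u. *)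
Lemma abs_quantile_gt0 (R : realType) (F : probability R R) (u : R) :
  no_atom_at_zero F -> 0 < u -> u < 1 -> 0 < abs_quantile F u.
Proof.
move=> F0 u0 u1; rewrite ltNge quantile_le// -ltNge.
rewrite [X in (X < _)%E](_ : _ = 0%E) ?lte_fin//.
rewrite /cdf /distribution /pushforward /= -[RHS]F0; congr (F _).
apply/seteqP; split=> x /=; rewrite in_itv/= normr_le0; first by move/eqP.
by move=> ->.
Qed.

Lemma prode_gt0 (R : realDomainType) (I : Type) (r : seq I) (f : I -> \bar R) :
  (forall i, 0 < f i)%E -> (0 < \prod_(i <- r) f i)%E.
Proof.
move=> f0; apply: (big_ind (fun x => 0 < x)%E) => [|x y|i _].
- by rewrite lte_fin.
- exact: mule_gt0.
- exact: f0.
Qed.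

(** If the integrals agreed, g - f >= 0 would have integral 0 and vanish almost everywhere, against
    its positivity on [E]. Finiteness allows the integral of f to be cancelled. *)
Lemma ge0_lt_integral d (T : measurableType d) (R : realType)
    (mu : {measure set T -> \bar R}) (f g : T -> R) (E : set T) :
  measurable_fun setT f -> measurable_fun setT g ->
  (forall w, 0 <= f w) -> (forall w, f w <= g w) ->
  (\int[mu]_w (g w)%:E < +oo)%E -> measurable E -> (0 < mu E)%E ->
  (forall w, E w -> f w < g w) ->
  (\int[mu]_w (f w)%:E < \int[mu]_w (g w)%:E)%E.
Proof.
move=> mf mg f0 fg goo mE E0 lt.
have mh : measurable_fun setT (fun w => g w - f w) by exact: measurable_funB.
have h0 w : 0 <= g w - f w by rewrite subr_ge0.
have foo : (\int[mu]_w (f w)%:E < +oo)%E.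
  apply: le_lt_trans goo; apply: ge0_le_integral => //=.
  - by move=> w _; rewrite lee_fin.
  - exact/measurable_EFinP.
  - exact/measurable_EFinP.
  - by move=> w _; rewrite lee_fin.
have -> : (\int[mu]_w (g w)%:E =
    \int[mu]_w (f w)%:E + \int[mu]_w (g w - f w)%:E)%E.
  rewrite -ge0_integralD//=.
  - by apply: eq_integral => w _; rewrite -EFinD addrC subrK.
  - by move=> w _; rewrite lee_fin.
  - exact/measurable_EFinP.
  - by move=> w _; rewrite lee_fin.
  - exact/measurable_EFinP.
rewrite lteDl//; last first.
  by rewrite ge0_fin_numE// integral_ge0// => w _; rewrite lee_fin.
rewrite lt_neqAle integral_ge0 ?andbT; last by move=> w _; rewrite lee_fin.
apply/eqP => /esym int0.
have mH : measurable_fun setT (fun w => (g w - f w)%:E).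
  exact/measurable_EFinP.
have [N [mN N0 sub]] : ae_eq mu setT (fun w => (g w - f w)%:E) (cst 0%E).
  apply/(ae_eq_integral_abs mu measurableT mH); rewrite -[RHS]int0.
  by apply: eq_integral => w _; rewrite gee0_abs// lee_fin.
move: E0; rewrite (@subset_measure0 _ _ _ mu E N) ?ltxx//.
move=> w Ew; apply: sub => /= /(_ I)[] /eqP.
by rewrite subr_eq0 gt_eqF// lt.
Qed.

Lemma self_norm_itv (R : realType) n (x : 'I_n -> R) :
  - Num.sqrt n%:R <= self_norm x <= Num.sqrt n%:R.
Proof. by rewrite -ler_norml -sqrtr_sqr ler_wsqrtr// self_norm_sqr_le. Qed.

Lemma sign_sum_bound (R : realType) n m (x : 'I_n -> R) :
  sign_sum m x <= \sum_(s : {ffun 'I_n -> bool}) n%:R ^+ m.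
Proof.
apply: ler_sum => s _; rewrite exprM lerXn2r ?nnegrE ?sqr_ge0//.
exact: self_norm_sqr_le.
Qed.

(** Nonnegative terms allow sum and integral to be exchanged. The self-normalized sum stays in
    [-sqrt n, sqrt n], where convergence identifies the real limit with the extended-real series. *)
Lemma expectation_series d (T : measurableType d) (R : realType)
    (P : probability T R) n (X : 'I_n -> {RV P >-> R}) (c : nat -> R) :
  (forall m, 0 <= c m) ->
  (forall x : R, - Num.sqrt n%:R <= x <= Num.sqrt n%:R ->
        cvgn (series (fun m => c m * x ^+ (2 * m)))) ->
  ('E_P[(fun w =>
      limn (series (fun m => c m * self_normalized_sum X w ^+ (2 * m))))%R] =
   \sum_(m <oo) (c m)%:E *
      'E_P[(fun w => self_normalized_sum X w ^+ (2 * m))%R])%E.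
Proof.
move=> c0 cvgc.
have mX i : measurable_fun setT (X i) by [].
have mZ m :
    measurable_fun setT (fun w => (self_normalized_sum X w ^+ (2 * m))%:E).
  apply/measurable_EFinP; apply: measurable_funX.
  exact: (measurable_self_norm mX).
have Z0 m w : (0 <= (self_normalized_sum X w ^+ (2 * m))%:E)%E.
  by rewrite lee_fin exprM exprn_ge0// sqr_ge0.
rewrite unlock.
transitivity (\int[P]_w
    \sum_(m <oo) (c m)%:E * (self_normalized_sum X w ^+ (2 * m))%:E)%E.
  apply: eq_integral => w _; rewrite -EFin_lim; last first.
    by apply: cvgc; exact: self_norm_itv.
  by congr (limn _); apply/funext => N /=; rewrite /series/= -sumEFin.
rewrite integral_nneseries//=.
- by apply: eq_eseriesr => m _; rewrite ge0_integralZl_EFin.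
- by move=> m; exact: measurable_funeM.
- by move=> m w _; apply: mule_ge0 => //; rewrite lee_fin c0.
Qed.

Theorem theorem4p1 (R : realType) (n : nat) (hn : (2 <= n)%N)
    (F G : probability R R)
    (ndF : nondegenerate_law F) (ndG : nondegenerate_law G)
    (symF : symmetric_law F) (symG : symmetric_law G)
    (F0 : no_atom_at_zero F) (G0 : no_atom_at_zero G)
    (ratio_nondecreasing : forall u v : R, 0 < u -> u <= v -> v < 1 ->
      abs_quantile F u / abs_quantile G u <=
      abs_quantile F v / abs_quantile G v)
    (d : measure_display) (T : measurableType d) (P : probability T R)
    (X : 'I_n -> {RV P >-> R}) (iidX : iid_sample X F)
    (d' : measure_display) (T' : measurableType d') (Q : probability T' R)
    (Y : 'I_n -> {RV Q >-> R}) (iidY : iid_sample Y G) :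
  [/\ forall m : nat,
        ('E_P[(fun w => self_normalized_sum X w ^+ (2 * m))%R] <=
         'E_Q[(fun w => self_normalized_sum Y w ^+ (2 * m))%R])%E,
      ~ (exists k : R,
          (fun u => abs_quantile F u / abs_quantile G u) = cst k
            %[ae lebesgue_measure in `]0, 1[%classic]) ->
      forall m : nat, (2 <= m)%N ->
        ('E_P[(fun w => self_normalized_sum X w ^+ (2 * m))%R] <
         'E_Q[(fun w => self_normalized_sum Y w ^+ (2 * m))%R])%E
    & forall c : nat -> R, (forall m, 0 <= c m) ->
      (forall x : R, - Num.sqrt n%:R <= x <= Num.sqrt n%:R ->
        cvgn (series (fun m => c m * x ^+ (2 * m)))) ->
      ('E_P[(fun w =>
          limn (series (fun m => c m * self_normalized_sum X w ^+ (2 * m))))%R] <=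
       'E_Q[(fun w =>
          limn (series (fun m => c m * self_normalized_sum Y w ^+ (2 * m))))%R])%E].
Proof.
have [d0 [T0 [P0 [U [mU PU]]]]] := exists_iid (unif R) n.
have itv i w : 0 < clip01 (U i w) /\ clip01 (U i w) < 1.
  by apply/andP; exact: clip01_itv.
pose x w i := abs_quantile F (clip01 (U i w)).
pose y w i := abs_quantile G (clip01 (U i w)).
have x0 w i : 0 < x w i by have [? ?] := itv i w; exact: abs_quantile_gt0.
have y0 w i : 0 < y w i by have [? ?] := itv i w; exact: abs_quantile_gt0.
(* A smaller ratio at [i] forces a smaller uniform value there, and the quantile function of [G] is
   nondecreasing. *)
have comonotone w i j : x w i / y w i < x w j / y w j -> y w i <= y w j.
  move=> lt; have [i0 i1] := itv i w; have [j0 j1] := itv j w.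
  have [ij|ji] := leP (clip01 (U i w)) (clip01 (U j w)).
    exact: quantile_nondecreasing.
  by move: lt; rewrite ltNge ratio_nondecreasing// ltW.
have cmp m w := @sign_sum_le R n m (x w) (y w) (x0 w) (y0 w) (comonotone w).
have mq (H : probability R R) i :
    measurable_fun setT (fun w => abs_quantile H (clip01 (U i w))).
  exact: (measurableT_comp (measurable_quantile_clip01 _) (mU i)).
have mx m : measurable_fun setT (fun w => sign_sum m (x w)).
  exact: (measurable_sign_sum m (mq F)).
have my m : measurable_fun setT (fun w => sign_sum m (y w)).
  exact: (measurable_sign_sum m (mq G)).
have EX m := expectation_sign_sum iidX m symF mU PU.
have EY m := expectation_sign_sum iidY m symG mU PU.
have N0 : (0 < (#|{ffun 'I_n -> bool}|%:R)%:E :> \bar R)%E.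
  by rewrite lte_fin ltr0n; apply/card_gt0P; exists [ffun=> false].
(* Turns the sums over sign vectors into multiples of the moments by a positive finite factor, which
   is then cancelled. *)
have sumE (e : \bar R) : (\sum_(s : {ffun 'I_n -> bool}) e =
    (#|{ffun 'I_n -> bool}|%:R)%:E * e)%E.
  by rewrite mule_natl sumr_const.
have le_moment m : ('E_P[(fun w => self_normalized_sum X w ^+ (2 * m))%R] <=
    'E_Q[(fun w => self_normalized_sum Y w ^+ (2 * m))%R])%E.
  rewrite -(lee_pmul2l _ N0)// -!sumE EX EY.
  apply: ge0_le_integral => //=.
  - by move=> w _; rewrite lee_fin sign_sum_ge0.
  - exact/measurable_EFinP.
  - exact/measurable_EFinP.
  - by move=> w _; rewrite lee_fin; have [] := cmp m w.
split=> // [nonconst m m2|c c0 cvgc]; last first.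
  rewrite !expectation_series//; apply: lee_nneseries => [m _ _|m _].
    rewrite mule_ge0 ?lee_fin// expectation_ge0// => w.
    by rewrite exprM exprn_ge0// sqr_ge0.
  by rewrite lee_wpmul2l ?lee_fin.
(* Otherwise the nondecreasing ratio would equal its value at 1/2 on the whole of ]0, 1[. *)
have [u [v [u0 uv v1 ruv]]] : exists u v : R, [/\ 0 < u, u < v, v < 1 &
    abs_quantile F u / abs_quantile G u < abs_quantile F v / abs_quantile G v].
  apply: contrapT => H; apply: nonconst.
  pose r u := abs_quantile F u / abs_quantile G u.
  exists (r 2^-1); apply: aeW => u /=; rewrite in_itv/= => /andP[u0 u1].
  have half0 : 0 < 2^-1 :> R by lra.
  have half1 : 2^-1 < 1 :> R by lra.
  have E s t : 0 < s -> s < t -> t < 1 -> r s = r t.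
    move=> s0 st t1; apply/eqP.
    rewrite eq_le ratio_nondecreasing ?(ltW st)//= leNgt.
    by apply/negP => lt; apply: H; exists s, t.
  rewrite -/(r u); have [h|h|->//] := ltgtP u 2^-1.
    exact: E.
  by apply/esym; exact: E.
have n0 : (0 < n)%N by exact: leq_trans hn.
pose i0 := Ordinal n0; pose i1 := Ordinal hn.
(* One coordinate is placed in ]0, u] and another in [v, 1[, the rest being free. This event has
   positive probability, and on it the ratios at [i0] and [i1] are separated by the values at u and
   v. *)
pose A i : set R := if i == i0 then `]0, u]%classic else
  if i == i1 then `[v, 1[%classic else setT.
have mA i : measurable (A i) by rewrite /A; case: ifP => // _; case: ifP.
have mcA i : measurable (@clip01 R @^-1` A i).
  by rewrite -[X in measurable X]setTI; exact: measurable_clip01.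
pose E := \bigcap_i (U i @^-1` (@clip01 R @^-1` A i)).
have E0 : (0 < P0 E)%E.
  rewrite /E (PU (fun i => @clip01 R @^-1` A i))//; apply: prode_gt0 => i.
  rewrite unif_clip01E// /A; case: ifP => _.
    have -> : `]0, u]%classic `&` `]0, 1[%classic = `]0, u]%classic.
      apply: setIidl => z /=; rewrite !in_itv/= => /andP[-> zu].
      by rewrite (le_lt_trans zu)// (lt_trans uv).
    by rewrite lebesgue_measure_itv/= lte_fin u0 -EFinB lte_fin subr0.
  case: ifP => _.
    have -> : `[v, 1[%classic `&` `]0, 1[%classic = `[v, 1[%classic.
      apply: setIidl => z /=; rewrite !in_itv/= => /andP[vz ->].
      by rewrite (lt_le_trans _ vz)// (lt_trans u0).
    by rewrite lebesgue_measure_itv/= lte_fin v1 -EFinB lte_fin subr_gt0.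
  by rewrite setTI lebesgue_measure_itv/= lte_fin ltr01 -EFinB lte_fin subr0.
rewrite -(lte_pmul2l _ N0)// -!sumE EX EY.
apply: (@ge0_lt_integral _ _ _ _ _ _ E) => //.
- by move=> w; exact: sign_sum_ge0.
- by move=> w; have [] := cmp m w.
(* The bound Z^2 <= n makes the larger integral finite, as the strict comparison requires. *)
- pose M : R := \sum_(s : {ffun 'I_n -> bool}) n%:R ^+ m.
  apply: (@le_lt_trans _ _ (\int[P0]_w M%:E)%E).
    apply: ge0_le_integral => //=.
    + by move=> w _; rewrite lee_fin sign_sum_ge0.
    + exact/measurable_EFinP.
    + by move=> w _; rewrite lee_fin sign_sum_bound.
  by rewrite integral_cst//= probability_setT mule1 ltry.
- apply: fin_bigcap_measurable => // i _.
  by rewrite -[X in measurable X]setTI; exact: mU.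
- move=> w Ew; have [_ lt] := cmp m w; apply: lt => //; exists i0, i1.
  have := Ew i0 I; have := Ew i1 I.
  rewrite /A /= !in_itv/= => /andP[vw w1] /andP[w0 wu].
  rewrite lt_eqF//; apply: le_lt_trans (lt_le_trans ruv _).
    by apply: ratio_nondecreasing => //; exact: lt_trans uv v1.
  by apply: ratio_nondecreasing => //; exact: lt_trans u0 uv.
Qed.
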